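(* Let $n\ge 5$ and $t\ge 0$ be integers, and let $G$ be a cactus with $n$ vertices and exactly $t$ cycles. Then $$SO(G)\le (n-2t-1)\sqrt{(n-1)^{2}+1}+2t\sqrt{(n-1)^{2}+4}+2\sqrt{2}\,t,$$ with equality if and only if $G\cong H(n,t)$.
   Context: All graphs are finite, simple and connected. For a graph $G$, $d_u$ denotes the degree of vertex $u$, and the Sombor index is $SO(G)=\sum_{uv\in E(G)}\sqrt{d_u^2+d_v^2}$. A cactus is a connected graph in which any two cycles have at most one common vertex. For integers $n,t$ with $n\ge 2t+1$, $H(n,t)$ denotes the graph obtained from the star $K_{1,n-1}$ with center $c$ by adding $t$ pairwise disjoint edges among its leaves; equivalently, it consists of $t$ triangles sharing the single common vertex $c$, together with $n-2t-1$ pendant vertices attached to $c$. *)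

(* Defs.v *)
From HB Require Import structures.
From mathcomp Require Import all_boot all_order all_algebra.
Set Implicit Arguments. Unset Strict Implicit. Unset Printing Implicit Defensive.
Import Order.TTheory GRing.Theory Num.Theory.

Section Graphs.
Variable T : finType.
Variable e : rel T.

Definition simple_graph : Prop := symmetric e /\ irreflexive e.

Definition connected_graph : Prop := forall x y : T, connect e x y.

Definition deg (x : T) : nat := #|[set y | e x y]|.

Definition cycle_edges (s : seq T) : {set {set T}} :=
  [set [set x; next s x] | x in s].

(* A cycle of the graph, viewed as a subgraph (its edge set): there is a
   sequence of k >= 3 pairwise distinct vertices v_0 .. v_(k-1) with
   v_i ~ v_(i+1) and v_(k-1) ~ v_0, whose edges form C. *)
Definition is_cycle (C : {set {set T}}) : Prop :=
  exists s : seq T, [/\ uniq s, 3 <= size s, cycle e s & C = cycle_edges s].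

Definition cycle_vertices (C : {set {set T}}) : {set T} :=
  \bigcup_(E in C) E.

Definition cactus : Prop :=
  forall C1 C2, is_cycle C1 -> is_cycle C2 -> C1 <> C2 ->
    #|cycle_vertices C1 :&: cycle_vertices C2| <= 1.

Definition has_num_cycles (t : nat) : Prop :=
  exists Cs : {set {set {set T}}},
    (forall C, C \in Cs <-> is_cycle C) /\ #|Cs| = t.

Local Open Scope ring_scope.
(* Sombor index: sum over (unordered) edges uv of sqrt(d_u^2 + d_v^2);
   written as half of the sum over ordered adjacent pairs. *)
Definition sombor (R : rcfType) : R :=
  (\sum_(x : T) \sum_(y : T | e x y)
     Num.sqrt ((deg x)%:R ^+ 2 + (deg y)%:R ^+ 2)) / 2%:R.
End Graphs.

Definition isomorphic (T T' : finType) (e : rel T) (e' : rel T') : Prop :=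
  exists f : T -> T', bijective f /\ forall x y, e' (f x) (f y) = e x y.

(* H(n,t) on vertex set {0,...,n-1}: center 0 adjacent to every other vertex,
   plus the t disjoint edges {2i+1, 2i+2}, i < t. *)
Definition H_rel (n t : nat) : rel 'I_n :=
  fun x y => (x != y) &&
    [|| (val x == 0)%N, (val y == 0)%N |
        [&& (val x <= 2 * t)%N, (val y <= 2 * t)%N & ((val x).-1 %/ 2 == (val y).-1 %/ 2)%N]].

(* Main.v *)
Require Import Defs.
From HB Require Import structures.
From mathcomp Require Import all_boot all_order all_algebra.
From mathcomp Require Import zify lra ring.
Set Implicit Arguments. Unset Strict Implicit. Unset Printing Implicit Defensive.
Import Order.TTheory GRing.Theory Num.Theory.

(** Give every edge the weight sqrt(d_u^2 + d_v^2), and put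
    A = sqrt((n-1)^2 + 1), K = 2 sqrt((n-1)^2 + 4) + 2 sqrt 2.
    Distinct cycles of a cactus are edge-disjoint, and the graph has n - 1 + t
    edges at most, so it suffices to bound the edges outside cycles and each
    cycle separately.  The ends of an edge on no triangle have no common
    neighbour, so their degrees add up to at most n and the edge weighs at most
    A.  A cycle of length k has no chord and no outside vertex sees two of its
    vertices, so its degrees add up to at most n + k; hence it weighs at most
    (k - 3) A + K, by convexity when k = 3 and by the Lipschitz bound
    sqrt(a^2 + b^2) <= a + b - 4 + 2 sqrt 2 with room to spare when k > 3.
    Each of these bounds is an equality exactly when some vertex of the graph
    is adjacent to all others, and a cactus with such a vertex is H(n, t). *)

(** * Inequalities for the edge weight as a function of the degrees *)

Section Hypot.
Local Open Scope ring_scope.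
Variable R : rcfType.
Implicit Types a b c q : R.

Definition hypot a b : R := Num.sqrt (a ^+ 2 + b ^+ 2).

Lemma hypotC a b : hypot a b = hypot b a.
Proof. by rewrite /hypot addrC. Qed.

Lemma hypot_ge0 a b : 0 <= hypot a b.
Proof. exact: sqrtr_ge0. Qed.

Lemma sqr_hypot a b : hypot a b ^+ 2 = a ^+ 2 + b ^+ 2.
Proof. by rewrite sqr_sqrtr // addr_ge0 ?sqr_ge0. Qed.

Lemma ler_hypot a b c d : a ^+ 2 + b ^+ 2 <= c ^+ 2 + d ^+ 2 -> hypot a b <= hypot c d.
Proof. exact: ler_wsqrtr. Qed.

Lemma ltr_hypot a b c d : a ^+ 2 + b ^+ 2 < c ^+ 2 + d ^+ 2 -> hypot a b < hypot c d.
Proof.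
move=> h; rewrite ltr_sqrt //; apply: le_lt_trans h.
by rewrite addr_ge0 ?sqr_ge0.
Qed.

Lemma ltr_hypotl a b : 0 <= a -> b != 0 -> a < hypot a b.
Proof.
move=> a0 b0; rewrite -[ltLHS]ger0_norm // -sqrtr_sqr ltr_sqrt.
  by rewrite ltrDl exprn_even_gt0.
by rewrite ltr_wpDl ?sqr_ge0 ?exprn_even_gt0.
Qed.

Lemma hypot22 : hypot 2 2 = 2 * Num.sqrt 2.
Proof.
apply/eqP; rewrite -(@eqrXn2 _ 2) ?mulr_ge0 ?sqrtr_ge0 ?hypot_ge0 //.
by rewrite sqr_hypot exprMn sqr_sqrtr //; apply/eqP; ring.
Qed.

(* [hypot] is 1-Lipschitz in each argument. *)
Lemma hypot_le_add a b : 2 <= a -> 2 <= b -> hypot a b <= a + b - 4 + 2 * Num.sqrt 2.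
Proof.
move=> a2 b2; have s0 : 0 <= Num.sqrt 2 :> R by exact: sqrtr_ge0.
have s2 : Num.sqrt 2 ^+ 2 = 2 :> R by rewrite sqr_sqrtr.
have s1 : 1 <= Num.sqrt 2 :> R by nra.
rewrite -(@ler_pXn2r _ 2) ?nnegrE ?hypot_ge0 ?sqr_hypot //; nra.
Qed.

(* Convexity of [x |-> hypot x c]. *)
Lemma hypot_spread a b c q : 0 <= q -> q <= a -> q <= b ->
  hypot a c + hypot b c <= hypot (a + b - q) c + hypot q c.
Proof.
move=> q0 qa qb.
have := (sqr_hypot a c, sqr_hypot b c, sqr_hypot (a + b - q) c, sqr_hypot q c).
move: (hypot_ge0 a c) (hypot_ge0 b c) (hypot_ge0 (a + b - q) c) (hypot_ge0 q c).
move: (hypot a c) (hypot b c) (hypot (a + b - q) c) (hypot q c).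
move=> r1 r2 r3 r4 h1 h2 h3 h4 [[[e1 e2] e3] e4].
(* [Y] is the product of the spread pair. Squaring the goal and cancelling reduces it to
   [r1 * r2 <= D + r3 * r4]. *)
pose Y := (a + b - q) * q; pose D := a * b - Y.
have D0 : 0 <= D.
  have -> : D = (a - q) * (b - q) by rewrite /D /Y; ring.
  by rewrite mulr_ge0 ?subr_ge0.
have p12 : (r1 * r2) ^+ 2 = (a ^+ 2 + c ^+ 2) * (b ^+ 2 + c ^+ 2) by rewrite exprMn e1 e2.
have p34 : (r3 * r4) ^+ 2 = ((a + b - q) ^+ 2 + c ^+ 2) * (q ^+ 2 + c ^+ 2).
  by rewrite exprMn e3 e4.
have r34 : 0 <= r3 * r4 by rewrite mulr_ge0.
have hY : Y - c ^+ 2 <= r3 * r4.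
  have [neg|pos] := ler0P (Y - c ^+ 2); first exact: le_trans r34.
  have Y0 : 0 <= Y - c ^+ 2 by exact: ltW.
  rewrite -(@ler_pXn2r _ 2) // p34 -subr_ge0.
  (* Brahmagupta's two-square identity; the spread pair still sums to [a + b]. *)
  have -> : ((a + b - q) ^+ 2 + c ^+ 2) * (q ^+ 2 + c ^+ 2) - (Y - c ^+ 2) ^+ 2
    = (c * (a + b)) ^+ 2 by rewrite /Y; ring.
  exact: sqr_ge0.
have h12 : r1 * r2 <= D + r3 * r4.
  have rD : 0 <= D + r3 * r4 by rewrite addr_ge0.
  have r12 : 0 <= r1 * r2 by rewrite mulr_ge0.
  rewrite -(@ler_pXn2r _ 2) // -subr_ge0.
  have -> : (D + r3 * r4) ^+ 2 - (r1 * r2) ^+ 2 = 2 * D * (r3 * r4 - (Y - c ^+ 2)).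
    have -> : (D + r3 * r4) ^+ 2 = D ^+ 2 + 2 * D * (r3 * r4) + (r3 * r4) ^+ 2 by ring.
    by rewrite p12 p34 /D /Y; ring.
  by rewrite mulr_ge0 ?subr_ge0 // mulr_ge0.
suff : (r1 + r2) ^+ 2 <= (r3 + r4) ^+ 2.
  by rewrite ler_pXn2r ?nnegrE ?addr_ge0.
rewrite !sqrrD e1 e2 e3 e4.
move: h12; rewrite /D /Y => h12; nra.
Qed.

Definition triangle_weight a b c : R := hypot a b + hypot b c + hypot c a.

Lemma triangle_weightC a b c : triangle_weight a b c = triangle_weight b c a.
Proof. by rewrite /triangle_weight -addrA addrC. Qed.

(** The edge joining the two moved corners gains because the sum of squares grows by
    [2 (a - 2) (b - 2)]; the two edges at [c] gain by [hypot_spread] with [q = 2]. *)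
Lemma triangle_weight_spread a b c : 2 <= a -> 2 <= b ->
  triangle_weight a b c <= triangle_weight (a + b - 2) 2 c.
Proof.
move=> a2 b2; rewrite /triangle_weight.
have h : hypot a b <= hypot (a + b - 2) 2 by apply: ler_hypot; nra.
have := @hypot_spread a b c 2 (ler0n R 2) a2 b2.
rewrite (hypotC a c) (hypotC (a + b - 2) c) => h'; lra.
Qed.

Lemma triangle_weight_spread_lt a b c : 2 < a -> 2 < b ->
  triangle_weight a b c < triangle_weight (a + b - 2) 2 c.
Proof.
move=> a2 b2; rewrite /triangle_weight.
have h : hypot a b < hypot (a + b - 2) 2 by apply: ltr_hypot; nra.
have := @hypot_spread a b c 2 (ler0n R 2) (ltW a2) (ltW b2).
rewrite (hypotC a c) (hypotC (a + b - 2) c) => h'; lra.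
Qed.

(** From [(a + b - 1)^2 + 1 = a^2 + b^2 + 2 (a - 1) (b - 1)]: equality needs [a + b = n] and one
    degree equal to 1, so that the other is [n - 1]. *)
Lemma edge_weight_leif (n a b : nat) : (0 < a)%N -> (0 < b)%N -> (a + b <= n)%N ->
  hypot a%:R b%:R <= hypot (n%:R - 1) 1 ?= iff (a == n.-1) || (b == n.-1).
Proof.
move=> a0 b0 abn; have n0 : (0 < n)%N by lia.
have -> : n%:R - 1 = n.-1%:R :> R by rewrite -subn1 natrB.
apply/leifP; case: ifP => [|ne].
  case/orP => /eqP h; last rewrite hypotC.
    by have -> : b = 1%N; [lia | rewrite h].
  by have -> : a = 1%N; [lia | rewrite h].
apply: ltr_hypot; rewrite expr1n -!natrX natr1 -natrD ltr_nat.
have h : ((a + b).-1 ^ 2 + 1 = a ^ 2 + b ^ 2 + 2 * (a.-1 * b.-1))%N.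
  by case: a b a0 b0 {abn ne} => // a [|b] // _ _; rewrite /= -!mulnn; lia.
have [h'|h'] := ltnP (a + b) n.
  have : ((a + b).-1 < n.-1)%N by lia.
  by rewrite -ltn_sqr; lia.
have : (0 < a.-1 * b.-1)%N by rewrite muln_gt0; lia.
have -> : n = (a + b)%N by lia.
by lia.
Qed.

(** Two spreads turn the degrees into [a + b + c - 4, 2, 2], and the first of these is at most
    [n - 1]. *)
Lemma triangle_weight_leif (n a b c : nat) :
  (1 < a)%N -> (1 < b)%N -> (1 < c)%N -> (a + b + c <= n + 3)%N ->
  triangle_weight a%:R b%:R c%:R
    <= 2 * hypot (n%:R - 1) 2 + 2 * Num.sqrt 2 ?= iff [|| a == n.-1, b == n.-1 | c == n.-1].
Proof.
move=> a2 b2 c2 abc; have n3 : (2 < n)%N by lia.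
have -> : n%:R - 1 = n.-1%:R :> R by rewrite -subn1 natrB //; lia.
set m := n.-1.
have mE : triangle_weight m%:R 2 2 = 2 * hypot m%:R 2 + 2 * Num.sqrt 2.
  by rewrite /triangle_weight hypot22 (hypotC 2 m%:R); ring.
rewrite -mE; apply/leifP; case: ifP => [|ne].
  case/or3P => /eqP h; rewrite h.
  - by have [-> ->] : b = 2%N /\ c = 2%N by lia.
  - have [-> ->] : a = 2%N /\ c = 2%N by lia.
    by rewrite triangle_weightC.
  have [-> ->] : a = 2%N /\ b = 2%N by lia.
  by rewrite -triangle_weightC.
have le2 k : (1 < k)%N -> 2 <= k%:R :> R by rewrite ler_nat.
have lt2 k : (2 < k)%N -> 2 < k%:R :> R by rewrite ltr_nat.
have pE : a%:R + b%:R - 2 = (a + b - 2)%N%:R :> R by rewrite natrB ?natrD //; lia.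
have qE : (a + b - 2)%N%:R + c%:R - 2 = (a + b + c - 4)%N%:R :> R.
  by rewrite -natrD -natrB; [congr _%:R; lia | lia].
have h1 := @triangle_weight_spread a%:R b%:R c%:R (le2 _ a2) (le2 _ b2).
have p2 : (1 < a + b - 2)%N by lia.
have h2 := @triangle_weight_spread (a + b - 2)%N%:R c%:R 2 (le2 _ p2) (le2 _ c2).
rewrite pE in h1; rewrite qE in h2.
have E : triangle_weight (a + b - 2)%N%:R 2 c%:R = triangle_weight (a + b - 2)%N%:R c%:R 2.
  by rewrite /triangle_weight !(hypotC 2) !(hypotC c%:R); ring.
rewrite E in h1.
have h3 : triangle_weight (a + b + c - 4)%N%:R 2 2 <= triangle_weight m%:R 2 2.
  have h : hypot (a + b + c - 4)%N%:R 2 <= hypot m%:R 2 :> R.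
    by apply: ler_hypot; rewrite lerD2r ler_pXn2r ?nnegrE // ler_nat /m; lia.
  by rewrite /triangle_weight !(hypotC 2 _%:R); lra.
(* Either one of the two spreads is strict, or two degrees already equal 2; then the third is
   [a + b + c - 4], which is below [n - 1] by [ne]. *)
have [ab|ab] := boolP ((2 < a) && (2 < b))%N.
  case/andP: ab => /lt2 a3 /lt2 b3.
  have := @triangle_weight_spread_lt a%:R b%:R c%:R a3 b3.
  by rewrite pE E => h; lra.
have [pc|pc] := boolP ((2 < a + b - 2) && (2 < c))%N.
  case/andP: pc => /lt2 p3 /lt2 c3.
  have := @triangle_weight_spread_lt (a + b - 2)%N%:R c%:R 2 p3 c3.
  by rewrite qE => h; lra.
have h : hypot (a + b + c - 4)%N%:R 2 < hypot m%:R 2 :> R.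
  by apply: ltr_hypot; rewrite ltrD2r ltr_pXn2r ?nnegrE // ltr_nat /m; lia.
suff : triangle_weight (a + b + c - 4)%N%:R 2 2 < triangle_weight m%:R 2 2 by move=> *; lra.
by rewrite /triangle_weight !(hypotC 2 _%:R); lra.
Qed.

(** Here [k] is the length of the cycle and [s] its degree sum. The bound on [w] is [hypot_le_add]
    summed over the cycle, each degree being counted in two edges. *)
Lemma long_cycle_weight_lt (n k s : nat) (w : R) : (4 < n)%N -> (3 < k)%N ->
  w <= 2 * s%:R - 4 * k%:R + 2 * Num.sqrt 2 * k%:R -> (s <= n + k)%N ->
  w < (k%:R - 3) * hypot (n%:R - 1) 1 + (2 * hypot (n%:R - 1) 2 + 2 * Num.sqrt 2).
Proof.
move=> n5 k4 hw hs.
have s0 : 0 <= Num.sqrt 2 :> R by exact: sqrtr_ge0.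
have s2 : Num.sqrt 2 ^+ 2 = 2 :> R by rewrite sqr_sqrtr.
have s32 : Num.sqrt 2 <= 3 / 2 :> R by nra.
have n5' : 5 <= n%:R :> R by rewrite (ler_nat _ 5).
have k4' : 4 <= k%:R :> R by rewrite (ler_nat _ 4).
have hs' : s%:R <= n%:R + k%:R :> R by rewrite -natrD ler_nat.
have n1 : 0 <= n%:R - 1 :> R by lra.
have hA : n%:R - 1 < hypot (n%:R - 1) 1 :> R by apply: ltr_hypotl; rewrite ?oner_eq0.
have hB : n%:R - 1 < hypot (n%:R - 1) 2 :> R by apply: ltr_hypotl; rewrite ?pnatr_eq0.
have : (k%:R - 3) * (n%:R - 1) <= (k%:R - 3) * hypot (n%:R - 1) 1 :> R.
  by rewrite ler_wpM2l ?ltW //; lra.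
(* Once both hypotenuses are bounded below by [n - 1], the margin is at least
   [4 (k - 3) - (k - 1) = 3 k - 11 > 0], using [n - 1 >= 4] and [sqrt 2 <= 3/2]. *)
have : (k%:R - 3) * 4 <= (k%:R - 3) * (n%:R - 1) :> R by rewrite ler_wpM2l; lra.
have : Num.sqrt 2 * (k%:R - 1) <= 3 / 2 * (k%:R - 1) :> R by rewrite ler_wpM2r; lra.
lra.
Qed.

End Hypot.

(** * Unordered pairs and successors along a cyclic sequence *)

Lemma set2_inj (T : finType) (a b c d : T) :
  [set a; b] = [set c; d] -> (a = c /\ b = d) \/ (a = d /\ b = c).
Proof.
move=> E.
have := (set21 a b, set22 a b); rewrite E !inE => -[/orP ha /orP hb].
have := (set21 c d, set22 c d); rewrite -E !inE => -[/orP hc /orP hd].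
by case: ha hb hc hd => /eqP ? [] /eqP ? [] /eqP ? [] /eqP ?; subst; auto.
Qed.

Section NextSeq.
Variables (T : eqType) (s : seq T).
Hypotheses (us : uniq s) (s3 : 2 < size s).

Lemma next_neq x : x \in s -> next s x != x.
Proof.
case/rot_to=> i s' Er; rewrite -(next_rot i us) Er.
have := s3; rewrite -(size_rot i) Er.
have := us; rewrite -(rot_uniq i) Er.
case: s' {Er} => [|y [|z s']] //=; rewrite !inE !negb_or eqxx.
by case/andP=> /and3P[xy _ _] _ _; rewrite eq_sym.
Qed.

(** Fails for length two. It keeps the two neighbours of a vertex on a cycle distinct, and the two
    orientations of a cycle disjoint. *)
Lemma next_next_neq x : x \in s -> next s (next s x) != x.
Proof.
case/rot_to=> i s' Er; rewrite -!(next_rot i us) Er.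
have := s3; rewrite -(size_rot i) Er.
have := us; rewrite -(rot_uniq i) Er.
case: s' {Er} => [|y [|z s']] //=; rewrite !inE !negb_or eqxx.
by case/andP=> /and3P[xy xz _] _ _; rewrite (eq_sym y x) (negPf xy) eqxx eq_sym.
Qed.

End NextSeq.

(** * Cycles of a cactus: chords, outside neighbours, degree sums, edge-disjointness *)

Section Cactus.
Variables (T : finType) (e : rel T).

Lemma mem_cycle_vertices (s : seq T) : cycle_vertices (cycle_edges s) =i s.
Proof.
move=> x; apply/bigcupP/idP => [[E /imsetP[y ys ->]]|xs].
  by rewrite !inE => /orP[] /eqP ->; rewrite ?mem_next.
by exists [set x; next s x]; rewrite ?set21 //; apply/imsetP; exists x.
Qed.

Definition simple_cycle (s : seq T) := [&& uniq s, 2 < size s & cycle e s].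

Lemma simple_cycleP C :
  is_cycle e C <-> exists2 s, simple_cycle s & C = cycle_edges s.
Proof.
split=> [[s [us s3 cs ->]]|[s /and3P[us s3 cs] ->]]; exists s => //.
by rewrite /simple_cycle us s3.
Qed.

Hypotheses (e_sym : symmetric e) (e_irr : irreflexive e) (e_cactus : cactus e).

(** Contrapositive of the cactus condition, the form in which later arguments use it. *)
Lemma cactus_cycle_eq s1 s2 x y : simple_cycle s1 -> simple_cycle s2 -> x != y ->
  x \in s1 -> y \in s1 -> x \in s2 -> y \in s2 -> cycle_edges s1 = cycle_edges s2.
Proof.
move=> c1 c2 xy x1 y1 x2 y2; apply/eqP/negPn/negP => /eqP ne.
have isC s : simple_cycle s -> is_cycle e (cycle_edges s).
  by move=> cs; apply/simple_cycleP; exists s.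
have := e_cactus (isC _ c1) (isC _ c2) ne.
apply/negP; rewrite -ltnNge -(_ : #|[set x; y]| = 2); last by rewrite cards2 xy.
apply: subset_leq_card; apply/subsetP => z; rewrite !inE !mem_cycle_vertices.
by case/orP=> /eqP ->; apply/andP.
Qed.

(** Otherwise [w] closes the arc of [s] from [x] to [y] into a second cycle through both; it must be
    the same cycle, yet it contains [w]. *)
Lemma outside_neighbor_uniq s w x y : simple_cycle s -> w \notin s ->
  x \in s -> y \in s -> e w x -> e w y -> x = y.
Proof.
move=> cs ws xs ys wx wy; apply/eqP/negPn/negP => xy.
have [us s3 ec] := and3P cs.
case: (rot_to_arc us xs ys xy) => i p1 p2 _ _ Er.
have c2 : simple_cycle (w :: rcons (x :: p1) y).
  have := us; rewrite -(rot_uniq i) Er -cat_rcons -cat_cons -rcons_cons cat_uniq => /andP[u1 _].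
  have := ec; rewrite -(rot_cycle i) Er /= rcons_cat /= -cat_rcons cat_path => /andP[pth _].
  apply/and3P; split.
  - rewrite cons_uniq u1 andbT; apply: contra ws => h.
    by rewrite -(mem_rot i) Er -cat_rcons -cat_cons -rcons_cons mem_cat h.
  - by rewrite /= size_rcons.
  - by rewrite /= rcons_path wx pth last_rcons e_sym wy.
have xy2 z : z \in [:: x; y] -> z \in w :: rcons (x :: p1) y.
  by rewrite !inE mem_rcons !inE => /orP[] ->; rewrite ?orbT.
have E := cactus_cycle_eq cs c2 xy xs ys (xy2 _ (mem_head _ _)) (xy2 _ (mem_last x [:: y])).
by move: ws; rewrite -mem_cycle_vertices E mem_cycle_vertices mem_head.
Qed.

(** The edge [xy] and an arc of [s] form a cycle meeting [s] in two vertices, hence [s] itself; so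
    [xy] is one of the edges of [s]. *)
Lemma no_chord s x y : simple_cycle s -> x \in s -> y \in s -> e x y ->
  y = next s x \/ x = next s y.
Proof.
move=> cs xs ys exy.
have [|ny] := eqVneq y (next s x); first by left.
have [|nx] := eqVneq x (next s y); first by right.
have xy : x != y by apply: contraTneq exy => ->; rewrite e_irr.
have [us s3 ec] := and3P cs.
case: (rot_to_arc us xs ys xy) => i p1 p2 _ _ Er.
have ur : uniq (rcons (x :: p1) y).
  by have := us; rewrite -(rot_uniq i) Er -cat_rcons -cat_cons -rcons_cons cat_uniq => /andP[].
have c2 : simple_cycle (rcons (x :: p1) y).
  have := ec; rewrite -(rot_cycle i) Er /= rcons_cat /= -cat_rcons cat_path => /andP[pth _].
  apply/and3P; split=> //.
  (* An empty arc would make [y] the successor of [x]. *)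
  - case: p1 Er {ur pth} => [|z p1] Er; last by rewrite /= size_rcons.
    by move: ny; rewrite -(next_rot i us) Er /= eqxx eqxx.
  - by rewrite /= rcons_path pth last_rcons e_sym exy.
have x2 : x \in rcons (x :: p1) y by rewrite rcons_cons mem_head.
have y2 : y \in rcons (x :: p1) y by rewrite mem_rcons mem_head.
have E := cactus_cycle_eq cs c2 xy xs ys x2 y2.
have /imsetP[z _] : [set y; x] \in cycle_edges s.
  rewrite E; apply/imsetP; exists y => //; congr [set _; _].
  by rewrite -(next_rotr 1 ur) rotr1_rcons /= eqxx.
by case/set2_inj=> [[-> ->]|[-> ->]]; auto.
Qed.

(** Double counting: a vertex of the cycle has at most two neighbours on it, any other vertex at
    most one. *)
Lemma sum_deg_cycle s : simple_cycle s -> \sum_(x <- s) deg e x <= #|T| + size s.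
Proof.
move=> cs; have [us s3 ec] := and3P cs.
rewrite big_uniq //=.
under eq_bigr => x _ do rewrite /deg -sum1dep_card.
rewrite (exchange_big_dep predT) //=.
have -> : #|T| + size s = \sum_y (1 + (y \in s)).
  by rewrite big_split /= sum1_card -big_mkcond /= sum1_card (card_uniqP us).
apply: leq_sum => y _; rewrite sum1dep_card.
have [ys|ys] := boolP (y \in s); last first.
  apply/card_le1_eqP => x1 x2; rewrite !inE => /andP[h1 h2] /andP[h3 h4].
  by apply: (outside_neighbor_uniq cs ys); rewrite // e_sym.
apply: (@leq_trans #|[set next s y; prev s y]|); last by rewrite cards2 ltnS leq_b1.
apply: subset_leq_card; apply/subsetP => x; rewrite !inE => /andP[xs exy].
case: (no_chord cs xs ys exy) => ->; last by rewrite eqxx.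
by rewrite prev_next // eqxx orbT.
Qed.

Lemma deg_cycle_gt1 s x : simple_cycle s -> x \in s -> 1 < deg e x.
Proof.
move=> /and3P[us s3 ec] xs.
have -> : 2 = #|[set next s x; prev s x]|.
  rewrite cards2; have [E|//] := eqVneq (next s x) (prev s x).
  by have := next_next_neq us s3 xs; rewrite E next_prev // eqxx.
apply: subset_leq_card; apply/subsetP => y; rewrite !inE => /orP[] /eqP ->.
  exact: next_cycle.
rewrite e_sym; exact: prev_cycle.
Qed.

(** Each edge in both orientations, matching the ordered pairs summed in [sombor]. *)
Definition darts (C : {set {set T}}) : {set T * T} := [set d | [set d.1; d.2] \in C].

Lemma sum_darts (V : nmodType) (G : T * T -> V) s : uniq s -> 2 < size s ->
  (\sum_(d in darts (cycle_edges s)) G d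
   = \sum_(x <- s) (G (x, next s x) + G (next s x, x)))%R.
Proof.
move=> us s3.
pose D1 := [set (x, next s x) | x in s]; pose D2 := [set (next s x, x) | x in s].
have -> : darts (cycle_edges s) = D1 :|: D2.
  apply/setP => -[a b]; rewrite !inE /=; apply/idP/idP.
    case/imsetP=> x xs /set2_inj[[-> ->]|[-> ->]]; apply/orP; [left|right];
      by apply/imsetP; exists x.
  case/orP=> /imsetP[x xs [-> ->]]; apply/imsetP; exists x => //.
  exact: setUC.

rewrite (eq_bigl [predU D1 & D2]) => [|d]; last by rewrite !inE.
(* A pair in both orientations would return to its start after two steps. *)
rewrite bigU /=; last first.
  rewrite -setI_eq0; apply/eqP/setP => -[a b]; rewrite !inE; apply/negP.
  case/andP=> /imsetP[x xs [-> ->]] /imsetP[y ys [E1 E2]].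
  by have := next_next_neq us s3 ys; rewrite -E1 E2 eqxx.
rewrite !big_imset /=; [|by move=> x y _ _ []|by move=> x y _ _ []].
by rewrite -big_split big_uniq.
Qed.

Lemma dart_sub_edge s d : simple_cycle s -> d \in darts (cycle_edges s) -> e d.1 d.2.
Proof.
case/and3P=> us s3 ec; rewrite inE => /imsetP[x xs].
have exn := next_cycle ec xs.
by case/set2_inj=> [[-> ->]|[-> ->]]; rewrite // e_sym.
Qed.

Lemma mem_darts s d : d \in darts (cycle_edges s) -> d.1 \in s /\ d.2 \in s.
Proof.
by rewrite inE => /imsetP[x xs] /set2_inj[[-> ->]|[-> ->]]; rewrite mem_next.
Qed.

(** Edge-disjointness of distinct cycles: the ends of a shared edge are two shared vertices. *)
Lemma darts_cycle_eq s1 s2 d : simple_cycle s1 -> simple_cycle s2 ->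
  d \in darts (cycle_edges s1) -> d \in darts (cycle_edges s2) ->
  cycle_edges s1 = cycle_edges s2.
Proof.
move=> c1 c2 d1 d2; have [x1 y1] := mem_darts d1; have [x2 y2] := mem_darts d2.
apply: (cactus_cycle_eq c1 c2 _ x1 y1 x2 y2).
by apply: contraTneq (dart_sub_edge c1 d1) => ->; rewrite e_irr.
Qed.

End Cactus.

(** * Dominating vertices and the weight bounds with their equality cases *)

Section Dom.
Variables (T : finType) (e : rel T).
Hypotheses (e_sym : symmetric e) (e_irr : irreflexive e) (e_cactus : cactus e).

Definition dominating (c : T) := deg e c == #|T|.-1.

Lemma dominatingP c : reflect (forall y, y != c -> e c y) (dominating c).
Proof.
have sub : [set y | e c y] \subset [set~ c].
  by apply/subsetP => y; rewrite !inE; apply: contraTneq => ->; rewrite e_irr.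
rewrite /dominating /deg -(cardsC1 c).
have -> : (#|[set y | e c y]| == #|[set~ c]|) = ([set~ c] \subset [set y | e c y]).
  exact: (subset_leqif_card sub).2.
apply: (iffP subsetP) => h y; first by move=> yc; have := h y; rewrite !inE; apply.
by rewrite !inE; apply: h.
Qed.

Lemma triangle_simple_cycle x y z : e x y -> e y z -> e z x -> simple_cycle e [:: x; y; z].
Proof.
have ne a b : e a b -> a != b by apply: contraTneq => ->; rewrite e_irr.
move=> xy yz zx; rewrite /simple_cycle /= xy yz zx !inE !andbT negb_or.
by rewrite !ne // e_sym.
Qed.

(** Otherwise [c] would be an outside vertex adjacent to two vertices of the cycle. *)
Lemma dominating_mem_cycle c s : dominating c -> simple_cycle e s -> c \in s.
Proof.
move=> /dominatingP dc cs; have [us s3 _] := and3P cs.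
apply/negPn/negP => ncs.
have [x xs] : exists x, x \in s by case: (s) s3 => // x s' _; exists x; rewrite mem_head.
have ns : next s x \in s by rewrite mem_next.
have adj z : z \in s -> e c z by move=> zs; apply: dc; apply: contraNneq ncs => <-.
have := outside_neighbor_uniq e_sym e_cactus cs ncs xs ns (adj _ xs) (adj _ ns).
by move/eqP; rewrite eq_sym (negPf (next_neq us s3 xs)).
Qed.

(** For a cycle of length [k] the degree sum is at least [n - 1 + 2 (k - 1)] and at most [n + k], so
    [k <= 3]. *)
Lemma dominating_cycle_size c s : dominating c -> simple_cycle e s -> size s = 3.
Proof.
move=> dc cs; have [us s3 _] := and3P cs.
have := sum_deg_cycle e_sym e_irr e_cactus cs.
have c_s := dominating_mem_cycle dc cs.
rewrite (big_rem c) //= (eqP dc).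
have : \sum_(y <- rem c s) 2 <= \sum_(y <- rem c s) deg e y.
  rewrite big_seq [leqRHS]big_seq; apply: leq_sum => y /mem_rem ys.
  exact: (deg_cycle_gt1 e_sym cs).
rewrite big_const_seq count_predT iter_addn_0 size_rem //.
have : 0 < #|T| by apply/card_gt0P; exists c.
by move: (\sum_(y <- rem c s) deg e y) #|T| (size s) s3 => a b k; lia.
Qed.

Local Open Scope ring_scope.
Variable R : rcfType.
Let n := #|T|.
Let A : R := hypot (n%:R - 1) 1.
Let K : R := 2 * hypot (n%:R - 1) 2 + 2 * Num.sqrt 2.
Let w (d : T * T) : R := hypot (deg e d.1)%:R (deg e d.2)%:R.

Lemma dart_weight_leif d : e d.1 d.2 ->
  (forall s, simple_cycle e s -> d \notin darts (cycle_edges s)) ->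
  w d <= A ?= iff [exists c, dominating c].
Proof.
case: d => x y /= exy nc.
have not_triangle z : e y z -> e z x -> False.
  move=> yz zx; have := nc _ (triangle_simple_cycle exy yz zx).
  rewrite inE /= => /negP; apply; apply/imsetP; exists x; rewrite ?mem_head //=.
  by rewrite eqxx.
(* A dominating vertex other than [x] and [y] would form a triangle with them, so the equality
   condition at this edge is the global one. *)
have -> : [exists c, dominating c] = (deg e x == n.-1) || (deg e y == n.-1).
  apply/existsP/orP => [[c dc]|[] h]; [|by exists x|by exists y].
  have [<-|cx] := eqVneq c x; first by left.
  have [<-|cy] := eqVneq c y; first by right.
  have /dominatingP dc' := dc.
  case: (not_triangle c); last by apply: dc'; rewrite eq_sym.
  by rewrite e_sym dc' // eq_sym.
apply: edge_weight_leif.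
- by apply/card_gt0P; exists y; rewrite inE.
- by apply/card_gt0P; exists x; rewrite inE e_sym.
rewrite -cardsUI (_ : _ :&: _ = set0) ?cards0 ?addn0 ?max_card //.
apply/setP => z; rewrite !inE; apply/negP => /andP[xz yz].
by apply: (not_triangle z) => //; rewrite e_sym.
Qed.

Lemma sum_next (F : T -> R) s : uniq s -> \sum_(x <- s) F (next s x) = \sum_(x <- s) F x.
Proof.
move=> us; rewrite -(big_map (next s) xpredT F); apply: perm_big.
apply: uniq_perm => //; first by rewrite map_inj_uniq //; apply: can_inj (prev_next us).
move=> x; apply/mapP/idP => [[y ys ->]|xs]; first by rewrite mem_next.
by exists (prev s x); rewrite ?mem_prev // next_prev.
Qed.

(** A dominating vertex excludes cycles longer than three, where the bound is strict; in a triangle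
    it is one of the corners, so the condition on their degrees is the global one. *)
Lemma cycle_weight_leif s : (4 < n)%N -> simple_cycle e s ->
  \sum_(x <- s) w (x, next s x) <= ((size s)%:R - 3) * A + K ?= iff [exists c, dominating c].
Proof.
move=> n5 cs; have [us s3 _] := and3P cs.
have sd := sum_deg_cycle e_sym e_irr e_cactus cs.
have [k4|k3] := ltnP 3 (size s).
  have -> : [exists c, dominating c] = false.
    apply/existsP => -[c dc].
    by move: k4; rewrite (dominating_cycle_size dc cs).
  apply/leifP; apply: (long_cycle_weight_lt n5 k4 _ sd).
  have gt1 x : x \in s -> 2 <= (deg e x)%:R :> R.
    by move=> xs; rewrite (ler_nat _ 2) (deg_cycle_gt1 e_sym cs).
  pose dg x : R := (deg e x)%:R; pose r : R := 2 * Num.sqrt 2 - 4.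
  apply: (@le_trans _ _ (\sum_(x <- s) (dg x + dg (next s x) + r))).
    rewrite big_seq [leRHS]big_seq; apply: ler_sum => x xs.
    rewrite (_ : dg x + _ + _ = dg x + dg (next s x) - 4 + 2 * Num.sqrt 2); last first.
      by rewrite /r; ring.
    by apply: hypot_le_add; apply: gt1; rewrite ?mem_next.
  rewrite 2!big_split /= (sum_next dg us) big_const_seq count_predT iter_addr addr0.
  have -> : (\sum_(x <- s) deg e x)%N%:R = \sum_(x <- s) dg x by rewrite natr_sum.
  by rewrite -[_ *+ size s]mulr_natl /r; lra.
have {k3} s3' : size s = 3 by apply/eqP; rewrite eqn_leq k3 s3.
rewrite s3' subrr mul0r add0r.
have dom_s : [exists c, dominating c] = has dominating s.
  apply/existsP/hasP => [[c dc]|[c _ dc]]; exists c => //.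
  exact: dominating_mem_cycle.
have gt1 : all (fun x => 1 < deg e x)%N s by apply/allP => x; apply: deg_cycle_gt1.
case: s s3' us cs sd dom_s gt1 {s3} => [|x [|y [|z []]]] //= _ us cs sd -> /and4P[hx hy hz _].
move: us; rewrite !inE negb_or !andbT => /andP[/andP[xy xz] yz].
rewrite !big_cons !big_nil /= !eqxx.
rewrite [y == x]eq_sym [z == x]eq_sym [z == y]eq_sym (negPf xy) (negPf xz) (negPf yz) ?eqxx.
rewrite orbF addr0 addrA.
apply: triangle_weight_leif => //.
by move: sd; rewrite !big_cons big_nil addn0 addnA.
Qed.

Variables (Cs : {set {set {set T}}}).
Hypothesis CsP : forall C, C \in Cs <-> is_cycle e C.

(** Every dart lies on at most one cycle. The codomain is general because both real weights and
    natural counts are summed. *)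
Lemma sum_edge_darts (V : nmodType) (G : T * T -> V) :
  \sum_(d | e d.1 d.2) G d =
    \sum_(d | e d.1 d.2 && (d \notin \bigcup_(C in Cs) darts C)) G d
    + \sum_(C in Cs) \sum_(d in darts C) G d.
Proof.
rewrite (bigID (fun d => d \notin \bigcup_(C in Cs) darts C)) /=; congr (_ + _).
under [RHS]eq_bigr => C _ do rewrite big_mkcond.
rewrite exchange_big /= big_mkcond; apply: eq_bigr => d _.
rewrite -big_mkcondr /= negbK.
have [/bigcupP[C CC dC]|dU] := boolP (d \in _); rewrite ?andbF ?andbT.
  have [s cs Es] := proj1 (simple_cycleP _ _) (proj1 (CsP _) CC).
  rewrite (dart_sub_edge e_sym cs) -?Es // (big_pred1 C) // => C'.
  apply/andP/eqP => [[CC' dC']|-> //].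
  have [s' cs' Es'] := proj1 (simple_cycleP _ _) (proj1 (CsP _) CC').
  rewrite Es Es'; apply: (darts_cycle_eq e_sym e_irr e_cactus cs' cs (d := d)).
    by rewrite -Es'.
  by rewrite -Es.
rewrite big_pred0 // => C; apply/negP => /andP[CC dC].
by case/negP: dU; apply/bigcupP; exists C.
Qed.

(** Subtracting [A] from every dart separates weights from the edge count and removes the cycle
    length: a cycle of length [k] contributes at most [2 ((k - 3) A + K) - 2 k A = 2 (K - 3 A)]. *)
Lemma sum_dart_excess_leif : (4 < n)%N -> (exists d, e d.1 d.2) ->
  \sum_(d | e d.1 d.2) (w d - A) <= #|Cs|%:R * (2 * (K - 3 * A))
  ?= iff [exists c, dominating c].
Proof.
move=> n5 [d0 ed0]; rewrite sum_edge_darts [#|Cs|%:R * _]mulr_natl.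
set U := \bigcup_(C in Cs) darts C; set dom := [exists c, dominating c].
have h1 : \sum_(d | e d.1 d.2 && (d \notin U)) (w d - A)
    <= \sum_(d | e d.1 d.2 && (d \notin U)) 0
    ?= iff [forall (d | e d.1 d.2 && (d \notin U)), dom].
  apply: leif_sum => d /andP[ed dU].
  have nc s : simple_cycle e s -> d \notin darts (cycle_edges s).
    move=> cs; apply: contra dU => ds; apply/bigcupP; exists (cycle_edges s) => //.
    by apply/CsP/simple_cycleP; exists s.
  have /leifP := dart_weight_leif ed nc; rewrite -/dom => h.
  by apply/leifP; case: dom h; rewrite ?subr_eq0 ?subr_lt0.
have h2 : \sum_(C in Cs) \sum_(d in darts C) (w d - A)
    <= \sum_(C in Cs) 2 * (K - 3 * A) ?= iff [forall C in Cs, dom].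
  apply: leif_sum => C /CsP/simple_cycleP[s cs ->]; have [us s3 _] := and3P cs.
  have -> : \sum_(d in darts (cycle_edges s)) (w d - A)
      = 2 * (\sum_(x <- s) w (x, next s x) - (size s)%:R * A).
    rewrite sum_darts // (eq_bigr (fun x => 2 * (w (x, next s x)) - 2 * A)); last first.
      by move=> x _; rewrite [w (next s x, x)]hypotC -/(w (x, next s x)); ring.
    rewrite sumrB -mulr_sumr big_const_seq count_predT iter_addr addr0 -(mulr_natl _ (size s)).
    ring.
  have /leifP := cycle_weight_leif n5 cs; rewrite -/dom => h.
  apply/leifP; case: (dom) h => [/eqP ->|h]; first by apply/eqP; ring.
  by rewrite ltr_pM2l //; lra.
have := leifD h1 h2; rewrite big1_eq add0r sumr_const.
(* The edge [d0] makes one of the two families nonempty, so the conjunction is not vacuously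
   true. *)
suff -> : [forall (d | e d.1 d.2 && (d \notin U)), dom] && [forall C in Cs, dom] = dom by [].
apply/idP/idP => [/andP[/forall_inP f1 /forall_inP f2]|d1].
  have [/bigcupP[C CC _]|dU] := boolP (d0 \in U); first exact: f2 CC.
  by apply: (f1 d0); rewrite ed0.
by apply/andP; split; apply/forall_inP.
Qed.

End Dom.

(** * Spanning trees and the number of edges *)

Section Tree.
Variables (T : finType) (e : rel T).
Hypotheses (e_sym : symmetric e) (e_irr : irreflexive e).

(** Undirected edges of the tree with root [r] and parent map [p]; a constant [p] with value [r]
    gives the star. *)
Definition parent_rel (r : T) (p : T -> T) : rel T :=
  fun x y => (x != r) && (y == p x) || (y != r) && (x == p y).

Lemma parent_rel_sym r p : symmetric (parent_rel r p).
Proof. by move=> x y; rewrite /parent_rel orbC. Qed.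

Lemma card_parent_rel r p : #|[set d : T * T | parent_rel r p d.1 d.2]| <= 2 * #|T|.-1.
Proof.
have sub : [set d : T * T | parent_rel r p d.1 d.2]
    \subset [set (x, p x) | x in [set~ r]] :|: [set (p x, x) | x in [set~ r]].
  apply/subsetP => -[x y]; rewrite !inE /=.
  by case/orP=> /andP[nr /eqP ->]; apply/orP; [left|right]; apply: imset_f; rewrite !inE.
apply: leq_trans (subset_leq_card sub) _; rewrite cardsU mul2n -addnn -(cardsC1 r).
by apply: leq_trans (leq_subr _ _) (leq_add _ _); apply: leq_imset_card.
Qed.

Lemma card_star c : #|[set d : T * T | parent_rel c (fun=> c) d.1 d.2]| = 2 * #|T|.-1.
Proof.
apply/eqP; rewrite eqn_leq card_parent_rel /=.
have <- : #|[set (x, c) | x in [set~ c]] :|: [set (c, x) | x in [set~ c]]| = 2 * #|T|.-1.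
  rewrite cardsU !card_imset; try by move=> ? ? [].
  rewrite cardsC1 (_ : _ :&: _ = set0) ?cards0 ?subn0 ?addnn ?mul2n //.
  apply/setP => -[a b]; rewrite !inE; apply/negP => /andP[/imsetP[x hx [_ ->]]].
  by case/imsetP=> y hy [_ E]; move: hy; rewrite -E !inE eqxx.
apply: subset_leq_card; apply/subsetP => -[a b]; rewrite !inE /parent_rel /=.
by case/orP=> /imsetP[x]; rewrite !inE => xc [-> ->]; rewrite eqxx xc ?orbT.
Qed.

(** The parent of a vertex is a neighbour strictly closer to [r], so iterating it reaches [r]. *)
Lemma spanning_tree r : connected_graph e ->
  exists2 p, forall x, x != r -> e x (p x) & forall x y, connect (parent_rel r p) x y.
Proof.
move=> conn.
have walk x : exists k, [exists q : k.-tuple T, path e r q && (last r q == x)].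
  have /connectP[q pq ->] := conn r x.
  by exists (size q); apply/existsP; exists (in_tuple q); rewrite pq /=.
pose dist x := ex_minn (walk x).
have step x : x != r -> exists2 y, e x y & dist y < dist x.
  move=> xr; rewrite {2}/dist; case: ex_minnP => m /existsP[[q /= /eqP szq]] /andP[pq /eqP lq] _.
  case/lastP: q szq pq lq => [|q z] szq; first by move=> _ /= E; rewrite E eqxx in xr.
  rewrite rcons_path last_rcons => /andP[pq ez] zx; subst z.
  exists (last r q); first by rewrite e_sym.
  rewrite -szq size_rcons ltnS /dist; case: ex_minnP => k _; apply.
  by apply/existsP; exists (in_tuple q); rewrite pq /=.
(* The default is taken only at the root. *)
pose p x := odflt x [pick y | e x y && (dist y < dist x)].
have pP x : x != r -> e x (p x) /\ dist (p x) < dist x.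
  move=> xr; rewrite /p; case: pickP => [y /andP[]//|no].
  by have [y exy dy] := step x xr; have := no y; rewrite exy dy.
exists p; first by move=> x /pP[].
have csym := sym_connect_sym (parent_rel_sym r p).
have root x : connect (parent_rel r p) x r.
  have [m] := ubnP (dist x); elim: m x => // m IH x dm.
  have [->|xr] := eqVneq x r; first exact: connect0.
  have [_ dp] := pP x xr.
  apply: connect_trans (IH (p x) (leq_trans dp dm)).
  by apply: connect1; rewrite /parent_rel xr eqxx.
by move=> x y; apply: connect_trans (root x) _; rewrite csym.
Qed.

(* Makes the cycles closed by edges off a spanning tree pairwise distinct, so that a connected
   graph with t cycles has at most n - 1 + t edges. *)
Lemma fundamental_cycle (f : rel T) d : symmetric f -> subrel f e ->
  (forall x y, connect f x y) -> e d.1 d.2 -> ~~ f d.1 d.2 ->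
  exists s, [/\ simple_cycle e s, d \in darts (cycle_edges s) &
    forall d', d' \in darts (cycle_edges s) -> ~~ f d'.1 d'.2 ->
      d' \in [set d; (d.2, d.1)]].
Proof.
case: d => x y /= f_sym fe conn exy nf.
have /connectP[q0 pq0 lq0] := conn y x.
case: (shortenP pq0) lq0 => q pq uq _ lq {q0 pq0}.
have lq' : last y q = x by [].
(* The cycle is an [f]-path from [y] to [x] closed by the single extra step from [x] to [y]; every
   edge of it outside [f] is therefore [d] up to orientation. *)
pose g a b := f a b || (a == x) && (b == y).
have cg : cycle g (y :: q).
  rewrite /= rcons_path lq' /g !eqxx orbT andbT.
  by apply: sub_path pq => a b ->.
exists (y :: q); split.
- apply/and3P; split=> //.
    case: q pq uq lq lq' cg => [|z [|z' q]] //= pq _ lq lq' _.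
      by rewrite lq' e_irr in exy.
    by rewrite lq' f_sym (negPf nf) in pq.
  apply: sub_cycle cg => a b /orP[/fe //|/andP[/eqP -> /eqP ->]] //.
- rewrite inE /=; apply/imsetP; exists x; first by rewrite -lq' mem_last.
  case/lastP: (q) uq lq' => [|q' z] uq; first by move=> /= <-; rewrite eqxx.
  rewrite last_rcons => zx; subst z; rewrite -rcons_cons in uq.
  by rewrite -rcons_cons -(next_rotr 1 uq) rotr1_rcons /= eqxx.
move=> [a b]; rewrite !inE /= => /imsetP[z zs E] nab.
have := next_cycle cg zs; case/orP=> [fz|/andP[/eqP zx /eqP nz]].
  by case/set2_inj: E nab => [[-> ->]|[-> ->]]; rewrite ?fz // f_sym fz.
by rewrite nz zx in E; case/set2_inj: E => [[-> ->]|[-> ->]]; rewrite eqxx ?orbT.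
Qed.

Hypothesis e_cactus : cactus e.
Variables (Cs : {set {set {set T}}}).
Hypothesis CsP : forall C, C \in Cs <-> is_cycle e C.

Lemma card_edge_darts (f : rel T) : subrel f e ->
  #|[set d | e d.1 d.2]| = #|[set d | f d.1 d.2]| + \sum_(d | e d.1 d.2) ~~ f d.1 d.2.
Proof.
move=> fe; rewrite -!sum1dep_card (bigID (fun d => f d.1 d.2)) /=; congr (_ + _).
  apply: eq_bigl => d; have [/fe ->|] := boolP (f d.1 d.2); by rewrite ?andbF.
by rewrite big_mkcondr; apply: eq_bigr => d _; case: (f _ _).
Qed.

(** Edges on no cycle belong to the tree. A cycle has at most one edge off the tree, since it is
    itself the fundamental cycle of any such edge. *)
Lemma card_edge_darts_le : connected_graph e -> 0 < #|T| ->
  #|[set d | e d.1 d.2]| <= 2 * (#|T|.-1 + #|Cs|).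
Proof.
move=> conn /card_gt0P[r _]; have [p pe ptree] := spanning_tree r conn.
set f := parent_rel r p in ptree.
have fe : subrel f e.
  by move=> x y /orP[/andP[xr /eqP ->]|/andP[yr /eqP ->]]; rewrite ?pe // e_sym pe.
have f_sym : symmetric f := parent_rel_sym r p.
rewrite (card_edge_darts fe) mulnDr; apply: leq_add; first exact: card_parent_rel.
rewrite (sum_edge_darts e_sym e_irr e_cactus CsP (fun d => nat_of_bool (~~ f d.1 d.2))).
rewrite big1 => [|d /andP[ed dU]]; last first.
  have [//|nf] := boolP (f d.1 d.2).
  have [s [cs ds _]] := fundamental_cycle f_sym fe ptree ed nf.
  case/negP: dU; apply/bigcupP; exists (cycle_edges s) => //.
  by apply/CsP/simple_cycleP; exists s.
rewrite add0r -[2 * _]mulnC -sum_nat_const; apply: leq_sum => C /CsP/simple_cycleP[s cs ->].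
rewrite (bigID (fun d => f d.1 d.2)) /= big1 => [|d /andP[_ ->] //]; rewrite add0r.
have [d /andP[ds nf]|none] := pickP (fun d => (d \in darts (cycle_edges s)) && ~~ f d.1 d.2);
  last by rewrite big_pred0.
have ed := dart_sub_edge e_sym cs ds.
have [s' [cs' ds' sub]] := fundamental_cycle f_sym fe ptree ed nf.
rewrite (darts_cycle_eq e_sym e_irr e_cactus cs cs' ds ds').
rewrite (eq_bigr (fun=> 1)) => [|d1 /andP[_ ->]//]; rewrite sum1dep_card.
apply: (@leq_trans #|[set d; (d.2, d.1)]|); last by rewrite cards2 ltnS leq_b1.
by apply: subset_leq_card; apply/subsetP => d'; rewrite inE => /andP[]; apply: sub.
Qed.

Lemma star_subrel c : dominating e c -> subrel (parent_rel c (fun=> c)) e.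
Proof.
move/(dominatingP e_irr) => cP x y /orP[] /andP[nc /eqP ->]; last exact: cP.
by rewrite e_sym; apply: cP.
Qed.

(** The star at [c] serves as spanning tree, and each cycle, passing through [c], has an edge
    avoiding [c]. *)
Lemma card_edge_darts_dominating c : connected_graph e -> dominating e c ->
  #|[set d | e d.1 d.2]| = 2 * (#|T|.-1 + #|Cs|).
Proof.
move=> conn dc; apply/eqP; rewrite eqn_leq card_edge_darts_le //=; last first.
  by apply/card_gt0P; exists c.
set f := parent_rel c (fun=> c).
rewrite (card_edge_darts (star_subrel dc)) mulnDr card_star leq_add2l.
rewrite (sum_edge_darts e_sym e_irr e_cactus CsP (fun d => nat_of_bool (~~ f d.1 d.2))).
apply: leq_trans (leq_addl _ _).
rewrite [2 * _]mulnC -sum_nat_const; apply: leq_sum => C /CsP/simple_cycleP[s cs ->].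
have [us s3 _] := and3P cs; rewrite sum_darts //.
have c_s := dominating_mem_cycle e_sym e_irr e_cactus dc cs.
(* The edge from the successor of [c] to the vertex after it avoids [c]; both of its darts are off
   the star. *)
rewrite (big_rem (next s c)) ?mem_next //=; apply: leq_trans (leq_addr _ _).
have h1 := next_neq us s3 c_s; have h2 := next_next_neq us s3 c_s.
by rewrite /f /parent_rel (negPf h1) (negPf h2) !andbF.
Qed.

End Tree.

(** * Flattening a list of pairs *)

Section FlattenPairs.
Variable T : eqType.
Implicit Type ps : seq (T * T).

Definition unpair ps : seq T := flatten [seq [:: d.1; d.2] | d <- ps].

Lemma size_unpair ps : size (unpair ps) = 2 * size ps.
Proof. by elim: ps => //= d ps; rewrite -/(unpair ps) => ->; lia. Qed.

Lemma mem_unpair ps x : (x \in unpair ps) = has (fun d => (x == d.1) || (x == d.2)) ps.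
Proof. by elim: ps => //= d ps; rewrite -/(unpair ps) !inE => ->; rewrite orbA. Qed.

Lemma nth_unpair x0 d0 ps q : q < size ps ->
  nth x0 (unpair ps) (2 * q) = (nth d0 ps q).1 /\
  nth x0 (unpair ps) (2 * q).+1 = (nth d0 ps q).2.
Proof.
elim: ps q => // d ps IH [|q] hq; first by rewrite muln0.
by rewrite mulnS; apply: IH.
Qed.

Lemma uniq_unpair ps : uniq ps -> {in ps, forall d, d.1 != d.2} ->
  {in ps &, forall d d' x, (x == d.1) || (x == d.2) -> (x == d'.1) || (x == d'.2) -> d = d'} ->
  uniq (unpair ps).
Proof.
elim: ps => //= d ps IH /andP[dps ups] ne disj; rewrite -/(unpair ps).
have notin x : (x == d.1) || (x == d.2) -> x \notin unpair ps.
  move=> xd; rewrite mem_unpair; apply/hasPn => d' d'ps; apply: contra dps => xd'.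
  by rewrite (disj d d' _ _ x) // inE ?eqxx ?d'ps ?orbT.
rewrite inE negb_or ne ?mem_head // !notin ?eqxx ?orbT //=.
apply: IH => // [d' h|d' d'' h' h'' x]; first by apply: ne; rewrite inE h orbT.
by apply: disj; rewrite inE ?h' ?h'' orbT.
Qed.

End FlattenPairs.

(** * Cacti with a dominating vertex are the graphs H(n,t) *)

Section Iso.
Variables (T : finType) (e : rel T).
Hypotheses (e_sym : symmetric e) (e_irr : irreflexive e).

Lemma isomorphic_H_dominating t : 0 < #|T| -> isomorphic e (@H_rel #|T| t) ->
  exists c, dominating e c.
Proof.
move=> n0 [f [[g fK gK] fe]]; exists (g (Ordinal n0)); apply/(dominatingP e_irr) => y yc.
rewrite -fe gK /H_rel /= andbT; apply: contra yc => /eqP E.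
by rewrite -(fK y) -E.
Qed.

Hypothesis e_cactus : cactus e.
Variables (Cs : {set {set {set T}}}).
Hypothesis CsP : forall C, C \in Cs <-> is_cycle e C.
Hypothesis conn : connected_graph e.
Variable c : T.
Hypothesis dc : dominating e c.

Let cP y : y != c -> e c y.
Proof. exact/dominatingP. Qed.

(** Otherwise [z] is outside the triangle [c, x, y] and adjacent to both [c] and [x]. Hence the
    edges avoiding [c] form a matching. *)
Lemma rim_neighbor_uniq x y z : x != c -> y != c -> z != c -> e x y -> e x z -> y = z.
Proof.
move=> xc yc zc xy xz; apply/eqP/negPn/negP => yz.
have tri : simple_cycle e [:: c; x; y].
  by apply: triangle_simple_cycle; rewrite ?cP // e_sym cP.
have zx : z != x by apply: contraTneq xz => ->; rewrite e_irr.
have zs : z \notin [:: c; x; y] by rewrite !inE !negb_or zc zx eq_sym.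
have E : c = x.
  apply: (outside_neighbor_uniq e_sym e_cactus tri zs); rewrite ?inE ?eqxx ?orbT //.
    by rewrite e_sym cP.
  by rewrite e_sym.
by rewrite E eqxx in xc.
Qed.

(** Comparing ranks selects one orientation of each edge avoiding [c]. *)
Definition rim_pairs : {set T * T} :=
  [set d | [&& d.1 != c, d.2 != c, e d.1 d.2 & enum_rank d.1 < enum_rank d.2]].

(** Of the [n - 1 + t] edges, where [t] is the number of cycles, the star takes [n - 1]; each of the
    two orientations of the rest is counted by [rim_pairs]. *)
Lemma card_rim_pairs : #|rim_pairs| = #|Cs|.
Proof.
have := card_edge_darts_dominating e_sym e_irr e_cactus CsP conn dc.
rewrite (card_edge_darts (star_subrel e_sym e_irr dc)) card_star mulnDr => /addnI.
rewrite (bigID (fun d => enum_rank d.1 < enum_rank d.2)) /=.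
rewrite [X in _ + X](reindex_inj (h := fun d => (d.2, d.1))) /=; last by move=> [a b] [? ?] [-> ->].
have nstar x y : e x y -> parent_rel c (fun=> c) x y = ~~ ((x != c) && (y != c)).
  move=> exy; rewrite /parent_rel; have [xc|] := eqVneq x c; have [yc|] := eqVneq y c => //.
  by rewrite xc yc e_irr in exy.
rewrite (_ : \sum_(d | _) _ = #|rim_pairs|) => [|]; last first.
  rewrite -sum1dep_card big_mkcond [RHS]big_mkcond; apply: eq_bigr => -[x y] _ /=.
  have [exy|] := boolP (e x y); last by rewrite !andbF.
  by rewrite nstar // negbK; case: (x != c); case: (y != c); case: (_ < _).
rewrite (_ : \sum_(d | _) _ = #|rim_pairs|) => [|]; last first.
  rewrite -sum1dep_card big_mkcond [RHS]big_mkcond; apply: eq_bigr => -[x y] _ /=.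
  rewrite e_sym; have [exy|] := boolP (e x y); last by rewrite !andbF.
  rewrite nstar 1?e_sym // negbK -leqNgt leq_eqVlt.
  have -> : (nat_of_ord (enum_rank x) == enum_rank y) = false.
    apply/negP => /eqP/val_inj/enum_rank_inj E.
    by rewrite E e_irr in exy.
  by case: (x != c); case: (y != c); case: (_ < _).
by rewrite addnn mul2n => /double_inj.
Qed.

Lemma rim_pair_edge x y : x != c -> y != c ->
  e x y = ((x, y) \in rim_pairs) || ((y, x) \in rim_pairs).
Proof.
move=> xc yc; rewrite !inE /= xc yc [e y x]e_sym /= -andb_orr -neq_ltn.
have [exy|] := boolP (e x y) => //=; apply/esym.
by apply: contraTneq exy => /val_inj/enum_rank_inj ->; rewrite e_irr.
Qed.

Lemma dominating_isomorphic_H : isomorphic e (@H_rel #|T| #|Cs|).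
Proof.
pose ps := enum rim_pairs.
have : size ps = #|Cs| by rewrite -cardE card_rim_pairs.
move: #|Cs| => t szps.
have psP d : d \in ps -> [/\ d.1 != c, d.2 != c, e d.1 d.2 & enum_rank d.1 < enum_rank d.2].
  by rewrite mem_enum inE => /and4P[].
have u_ps : uniq (unpair ps).
  apply: uniq_unpair; first exact: enum_uniq.
    by move=> d /psP[_ _ + _]; apply: contraTneq => ->; rewrite e_irr.
  move=> [a b] [a' b'] /psP[/= ac bc ab lab] /psP[/= ac' bc' ab' lab'] x.
  case/orP=> /eqP-> /orP[] /eqP E; subst.
  - by congr (_, _); apply: (rim_neighbor_uniq ac').
  (* Sharing a vertex crosswise would make the pairs reverses of each other, against the rank
     order. *)
  - have E : b = a' by apply: (rim_neighbor_uniq bc'); rewrite // e_sym.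
    by subst; have := ltn_trans lab lab'; rewrite ltnn.
  - have E : a = b' by apply: (rim_neighbor_uniq ac'); rewrite // e_sym.
    by subst; have := ltn_trans lab lab'; rewrite ltnn.
  by congr (_, _); apply: (rim_neighbor_uniq bc'); rewrite // e_sym.
(* The isomorphism sends a vertex to its position in [L]: the center, then the triangles pair by
   pair, then the pendant vertices. *)
pose L0 := c :: unpair ps; pose L := L0 ++ [seq x <- enum T | x \notin L0].
have uL : uniq L.
  rewrite cat_uniq filter_uniq ?enum_uniq // andbT; apply/andP; split; last first.
    by apply/hasPn => x; rewrite mem_filter => /andP[].
  rewrite /= u_ps andbT mem_unpair; apply/hasPn => d /psP[h1 h2 _ _].
  by rewrite negb_or !(eq_sym c) h1.
have LP x : x \in L by rewrite mem_cat mem_filter mem_enum andbT orbN.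
have sizeL : size L = #|T| by rewrite -(card_uniqP uL); apply: eq_card => x; rewrite LP.
have ltL x : index x L < #|T| by rewrite -sizeL index_mem.
have idx d q : q < size ps -> nth d ps q = d ->
    index d.1 L = (2 * q).+1 /\ index d.2 L = (2 * q).+2.
  move=> hq nq; have hs : (2 * q).+1 < size (unpair ps).
    by rewrite size_unpair -[(2 * q).+2]/(2 + 2 * q) -mulnS leq_pmul2l.
  have hs' : 2 * q < size (unpair ps) by apply: ltnW.
  have [E1 E2] := nth_unpair c d hq; rewrite nq in E1 E2.
  have szL : size (unpair ps) < size L by rewrite /L size_cat /=; lia.
  have n1 : nth c L (2 * q).+1 = d.1 by rewrite nth_cat /= ltnS hs'.
  have n2 : nth c L (2 * q).+2 = d.2 by rewrite nth_cat /= ltnS hs.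
  have lt1 := leq_ltn_trans hs' szL; have lt2 := leq_ltn_trans hs szL.
  by rewrite -n1 -n2 !index_uniq.
have idxc : index c L = 0 by rewrite /= eqxx.
clearbody L.
have idx_inj x y : index x L = index y L -> x = y by exact: (index_inj c (LP x) (LP y)).
exists (fun x => Ordinal (ltL x)); split.
  apply: inj_card_bij; last by rewrite card_ord.
  by move=> x y [] /idx_inj.
have index0 x : (index x L == 0) = (x == c).
  by apply/eqP/eqP => [h|->] //; apply: idx_inj; rewrite h idxc.
move=> x y; rewrite /H_rel -val_eqE /= !index0.
have -> : (index x L == index y L) = (x == y) by apply/eqP/eqP => [/idx_inj|->].
have [->|xy] := eqVneq x y; first by rewrite e_irr.
have [xc|xc] := eqVneq x c; first by rewrite xc cP // -xc eq_sym.
have [yc|yc] := eqVneq y c; first by rewrite yc e_sym cP.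
rewrite /= rim_pair_edge //; apply/idP/idP; last first.
  have pairH d : d \in rim_pairs ->
      exists q, [/\ q < t, index d.1 L = (2 * q).+1 & index d.2 L = (2 * q).+2].
    rewrite -mem_enum -/ps => dps; exists (index d ps).
    have hq : index d ps < size ps by rewrite index_mem.
    by have [-> ->] := idx d _ hq (nth_index d dps); rewrite -szps.
  by case/orP=> /pairH[q [hq /= -> ->]]; apply/and3P; split; lia.
case/and3P=> hx hy /eqP hxy.
have x0 : 0 < index x L by rewrite lt0n index0.
have y0 : 0 < index y L by rewrite lt0n index0.
have nxy : index x L != index y L by apply: contra xy => /eqP/idx_inj ->.
(* The pair number [q] occupies positions [2q + 1] and [2q + 2], as in [H_rel]; [x] and [y] must
   fill them in one order or the other. *)
pose q := (index x L).-1 %/ 2; have hq : q < size ps by rewrite szps /q; lia.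
have [d0 d0ps] : exists d, d = nth (c, c) ps q by eexists.
have dps : d0 \in rim_pairs by rewrite -mem_enum d0ps mem_nth.
have [i1 i2] : index d0.1 L = (2 * q).+1 /\ index d0.2 L = (2 * q).+2.
  by apply: idx; rewrite // d0ps; apply: set_nth_default.
have [lxy|lyx] := ltnP (index x L) (index y L).
  have <- : d0.1 = x by apply: idx_inj; rewrite i1 /q; lia.
  have <- : d0.2 = y by apply: idx_inj; rewrite i2 /q; lia.
  by case: (d0) dps => ? ? /= ->.
have <- : d0.1 = y by apply: idx_inj; rewrite i1 /q; lia.
have <- : d0.2 = x by apply: idx_inj; rewrite i2 /q; lia.
by case: (d0) dps => ? ? /= ->; rewrite orbT.
Qed.

End Iso.

(** * Combining the excess bound with the edge count *)

Local Open Scope ring_scope.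

Theorem theorem3p1 (R : rcfType) (T : finType) (e : rel T) (t : nat) :
  simple_graph e -> connected_graph e -> (5 <= #|T|)%N ->
  cactus e -> has_num_cycles e t ->
  let n : R := (#|T|)%:R in
  let bound : R :=
    (n - 2 * t%:R - 1) * Num.sqrt ((n - 1) ^+ 2 + 1)
    + 2 * t%:R * Num.sqrt ((n - 1) ^+ 2 + 4)
    + 2 * Num.sqrt 2 * t%:R in
  sombor e R <= bound /\ (sombor e R = bound <-> isomorphic e (@H_rel #|T| t)).
Proof.
move=> [e_sym e_irr] conn n5 e_cactus [Cs [CsP <-]] n bound.
have n0 : (0 < #|T|)%N by apply: leq_trans n5.
have edge : exists d : T * T, e d.1 d.2.
  have /card_gt1P[x [y [_ _ xy]]] : (1 < #|T|)%N by apply: leq_trans n5.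
  by have [p pe _] := spanning_tree e_sym x conn; exists (y, p y); rewrite /= pe // eq_sym.
pose A := hypot (n - 1) 1; pose B := hypot (n - 1) 2.
pose w (d : T * T) : R := hypot (deg e d.1)%:R (deg e d.2)%:R.
pose D : R := #|[set d : T * T | e d.1 d.2]|%:R; pose k : R := #|Cs|%:R.
have boundE : bound = (n - 2 * k - 1) * A + 2 * k * B + 2 * Num.sqrt 2 * k.
  by rewrite /bound /A /B /hypot expr1n (_ : 2 ^+ 2 = 4) //; ring.
(* With [D <= 2 (n - 1 + k)] and excess at most [2 k (K - 3 A)], half the total is at most
   [(n - 1 - 2 k) A + k K], which is [bound] since [K = 2 B + 2 sqrt 2]. *)
have somborE : sombor e R = (\sum_(d | e d.1 d.2) (w d - A) + D * A) / 2.
  by rewrite sumrB sumr_const mulr_natl cardsE subrK /sombor pair_big_dep.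
have hsum := sum_dart_excess_leif e_sym e_irr e_cactus R CsP n5 edge.
rewrite -/n -/A -/B -/k in hsum.
have hn : (#|T|.-1)%:R = n - 1 :> R by rewrite -subn1 natrB.
have DE m : (m == 2 * (#|T|.-1 + #|Cs|))%N -> m%:R = 2 * (n - 1 + k) :> R.
  by move/eqP->; rewrite natrM natrD hn.
have D_le : D <= 2 * (n - 1 + k).
  rewrite -(DE _ (eqxx _)) ler_nat.
  exact: (card_edge_darts_le e_sym e_irr e_cactus CsP conn n0).
have A0 : 0 <= A by apply: hypot_ge0.
have DA : D * A <= 2 * (n - 1 + k) * A by rewrite ler_wpM2r.
have [/existsP[c dc]|nodom] := boolP [exists c, dominating e c].
  have iso := dominating_isomorphic_H e_sym e_irr e_cactus CsP conn dc.
  suff E : sombor e R = bound by rewrite E; split.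
  have eqD : D = 2 * (n - 1 + k).
    apply: DE; apply/eqP.
    exact: (card_edge_darts_dominating e_sym e_irr e_cactus CsP conn dc).
  have dom : [exists c, dominating e c] by apply/existsP; exists c.
  move/leifP: hsum; rewrite dom => /eqP hS.
  by rewrite somborE hS eqD boundE; field.
have lt : sombor e R < bound.
  move/leifP: hsum; rewrite (negPf nodom) => hS.
  by rewrite somborE boundE; lra.
split; first exact: ltW.
split=> [E|iso]; first by rewrite E ltxx in lt.
have [c dc] := isomorphic_H_dominating e_irr n0 iso.
by case/existsP: nodom; exists c.
Qed.
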